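(* (Strong normalisation.) If $\Upsilon;\Gamma\vdash t:A$ is derivable, then $t\in\mathsf{SN}$, i.e. every ultra-reduction sequence starting from $t$ is finite.
   Context: The $\mathcal L_!^{\mathcal S}$-calculus. Let $\mathcal S$ be a commutative semiring, whose elements are called scalars. Propositions are generated by $A ::= \mathfrak 1\mid A\multimap A\mid A\otimes A\mid\top\mid\mathfrak 0\mid A\mathbin{\&}A\mid A\oplus A\mid {!}A$. Proof-terms, taken modulo $\alpha$-equivalence, are generated by (with $a\in\mathcal S$) $t ::= x\mid t\boxplus u\mid a\bullet t\mid a.\star\mid\delta_{\mathfrak 1}(t,u)\mid\lambda x^A.t\mid t\,u\mid t\otimes u\mid\delta_\otimes(t,x^Ay^B.u)\mid\langle\rangle\mid\delta_{\mathfrak 0}(t)\mid\langle t,u\rangle\mid\delta_{\&}^1(t,x^A.u)\mid\delta_{\&}^2(t,x^B.u)\mid\mathit{inl}(t)\mid\mathit{inr}(t)\mid\delta_\oplus(t,x^A.u,y^B.v)\mid {!}t\mid\delta_!(t,x^A.u)$. Variables before a dot are bound in the term after it; $(u/x)t$ is capture-avoiding substitution of $u$ for $x$ in $t$. Judgements $\Upsilon;\Gamma\vdash t:A$ have an intuitionistic context $\Upsilon$ and a linear context $\Gamma$ (finite sets of typed variables; $\Gamma,\Delta$ is disjoint union). Typing rules: - $\Upsilon;x^A\vdash x:A$; and $\Upsilon,x^A;\varnothing\vdash x:A$. - If $\Upsilon;\Gamma\vdash t:A$ and $\Upsilon;\Gamma\vdash u:A$ then $\Upsilon;\Gamma\vdash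 t\boxplus u:A$. If $\Upsilon;\Gamma\vdash t:A$ then $\Upsilon;\Gamma\vdash a\bullet t:A$. - $\Upsilon;\varnothing\vdash a.\star:\mathfrak 1$. If $\Upsilon;\Gamma\vdash t:\mathfrak 1$ and $\Upsilon;\Delta\vdash u:A$ then $\Upsilon;\Gamma,\Delta\vdash\delta_{\mathfrak 1}(t,u):A$. - If $\Upsilon;\Gamma,x^A\vdash t:B$ then $\Upsilon;\Gamma\vdash\lambda x^A.t:A\multimap B$. If $\Upsilon;\Gamma\vdash t:A\multimap B$ and $\Upsilon;\Delta\vdash u:A$ then $\Upsilon;\Gamma,\Delta\vdash t\,u:B$. - If $\Upsilon;\Gamma\vdash t:A$ and $\Upsilon;\Delta\vdash u:B$ then $\Upsilon;\Gamma,\Delta\vdash t\otimes u:A\otimes B$. If $\Upsilon;\Gamma\vdash t:A\otimes B$ and $\Upsilon;\Delta,x^A,y^B\vdash u:C$ then $\Upsilon;\Gamma,\Delta\vdash\delta_\otimes(t,x^Ay^B.u):C$. - $\Upsilon;\Gamma\vdash\langle\rangle:\top$. If $\Upsilon;\Gamma\vdash t:\mathfrak 0$ then $\Upsilon;\Gamma,\Delta\vdash\delta_{\mathfrak 0}(t):C$. - If $\Upsilon;\Gamma\vdash t:A$ and $\Upsilon;\Gamma\vdash u:B$ then $\Upsilon;\Gamma\vdash\langle t,u\rangle:A\mathbin{\&}B$. If $\Upsilon;\Gamma\vdash t:A\mathbin{\&}B$ and $\Upsilon;\Delta,x^A\vdash u:C$ (resp. $\Upsilon;\Delta,x^B\vdash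 u:C$) then $\Upsilon;\Gamma,\Delta\vdash\delta_{\&}^1(t,x^A.u):C$ (resp. $\delta_{\&}^2(t,x^B.u):C$). - If $\Upsilon;\Gamma\vdash t:A$ (resp. $t:B$) then $\Upsilon;\Gamma\vdash\mathit{inl}(t):A\oplus B$ (resp. $\mathit{inr}(t):A\oplus B$). If $\Upsilon;\Gamma\vdash t:A\oplus B$, $\Upsilon;\Delta,x^A\vdash u:C$ and $\Upsilon;\Delta,y^B\vdash v:C$ then $\Upsilon;\Gamma,\Delta\vdash\delta_\oplus(t,x^A.u,y^B.v):C$. - If $\Upsilon;\varnothing\vdash t:A$ then $\Upsilon;\varnothing\vdash {!}t:{!}A$. If $\Upsilon;\Gamma\vdash t:{!}A$ and $\Upsilon,x^A;\Delta\vdash u:B$ then $\Upsilon;\Gamma,\Delta\vdash\delta_!(t,x^A.u):B$. The reduction of the calculus is the closure under arbitrary term contexts of the following rules (R): $\delta_{\mathfrak 1}(a.\star,t)\to a\bullet t$; $(\lambda x^A.t)\,u\to(u/x)t$; $\delta_\otimes(u\otimes v,x^Ay^B.w)\to(u/x,v/y)w$; $\delta_{\&}^i(\langle t_1,t_2\rangle,x^A.v)\to(t_i/x)v$ ($i=1,2$); $\delta_\oplus(\mathit{inl}(t),x^A.v,y^B.w)\to(t/x)v$; $\delta_\oplus(\mathit{inr}(u),x^A.v,y^B.w)\to(u/y)w$; $\delta_!({!}t,x^A.u)\to(t/x)u$; $a.\star\boxplus b.\star\to(a+b).\star$; $(\lambda x^A.t)\boxplus(\lambda x^A.u)\to\lambda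 x^A.(t\boxplus u)$; $\delta_\otimes(t\boxplus u,x^Ay^B.v)\to\delta_\otimes(t,x^Ay^B.v)\boxplus\delta_\otimes(u,x^Ay^B.v)$; $\langle\rangle\boxplus\langle\rangle\to\langle\rangle$; $\langle t,u\rangle\boxplus\langle v,w\rangle\to\langle t\boxplus v,u\boxplus w\rangle$; $\delta_\oplus(t\boxplus u,x^A.v,y^B.w)\to\delta_\oplus(t,x^A.v,y^B.w)\boxplus\delta_\oplus(u,x^A.v,y^B.w)$; $\delta_!(t\boxplus u,x^A.v)\to\delta_!(t,x^A.v)\boxplus\delta_!(u,x^A.v)$; $a\bullet b.\star\to(a\times b).\star$; $a\bullet\lambda x^A.t\to\lambda x^A.a\bullet t$; $\delta_\otimes(a\bullet t,x^Ay^B.v)\to a\bullet\delta_\otimes(t,x^Ay^B.v)$; $a\bullet\langle\rangle\to\langle\rangle$; $a\bullet\langle t,u\rangle\to\langle a\bullet t,a\bullet u\rangle$; $\delta_\oplus(a\bullet t,x^A.v,y^B.w)\to a\bullet\delta_\oplus(t,x^A.v,y^B.w)$; $\delta_!(a\bullet t,x^A.v)\to a\bullet\delta_!(t,x^A.v)$. Ultra-reduction is the closure under arbitrary term contexts of the rules (R) together with $t\boxplus u\to t$, $t\boxplus u\to u$, $a\bullet t\to t$. $\mathsf{SN}$ is the set of proof-terms that strongly normalise (for ultra-reduction, which contains the reduction of the calculus). *)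

(* Defs.v *)
From mathcomp Require Import all_boot ssralg.

Set Implicit Arguments.
Unset Strict Implicit.
Unset Printing Implicit Defensive.

Inductive proposition : Type :=
| One
| Lolli (A B : proposition)
| Tensor (A B : proposition)
| Top
| Zero
| With (A B : proposition)
| Plus (A B : proposition)
| Bang (A : proposition).

(* Proof-terms modulo alpha-equivalence, in de Bruijn notation: there is one   *)
(* syntactic class of variables, shared by the intuitionistic and the linear   *)
(* context, and [Var n] is the variable bound by the n-th enclosing binder or, *)
(* beyond these, a free variable. The propositions decorating the bound        *)
(* variables are kept.                                                         *)
Inductive term (S : Type) : Type :=
| Var (n : nat)
| Sum (t u : term S)                              (* t [+] u                *)
| Scal (a : S) (t : term S)                       (* a . t                  *)
| Star (a : S)                                    (* a.star                 *)
| ElimOne (t u : term S)                          (* delta_1 (t, u)         *)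
| Lam (A : proposition) (t : term S)              (* binds 0 in t           *)
| App (t u : term S)
| Tens (t u : term S)
| ElimTensor (t : term S) (A B : proposition) (u : term S)
    (* delta_tensor (t, x^A y^B . u): in u, x is 1 and y is 0 *)
| Unit                                            (* <>                     *)
| ElimZero (t : term S)
| Pair (t u : term S)
| ElimWith1 (t : term S) (A : proposition) (u : term S)   (* binds 0 in u   *)
| ElimWith2 (t : term S) (B : proposition) (u : term S)   (* binds 0 in u   *)
| Inl (t : term S)
| Inr (t : term S)
| ElimPlus (t : term S) (A : proposition) (u : term S)
           (B : proposition) (v : term S)         (* binds 0 in u, 0 in v   *)
| Prom (t : term S)                               (* !t                     *)
| ElimBang (t : term S) (A : proposition) (u : term S).   (* binds 0 in u   *)

Arguments Var {S} n.
Arguments Unit {S}.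

Definition up_ren (r : nat -> nat) (n : nat) : nat := if n is m.+1 then (r m).+1 else 0.

Fixpoint rename (S : Type) (r : nat -> nat) (t : term S) : term S :=
  match t with
  | Var n => Var (r n)
  | Sum t u => Sum (rename r t) (rename r u)
  | Scal a t => Scal a (rename r t)
  | Star a => Star a
  | ElimOne t u => ElimOne (rename r t) (rename r u)
  | Lam A t => Lam A (rename (up_ren r) t)
  | App t u => App (rename r t) (rename r u)
  | Tens t u => Tens (rename r t) (rename r u)
  | ElimTensor t A B u =>
      ElimTensor (rename r t) A B (rename (up_ren (up_ren r)) u)
  | Unit => Unit
  | ElimZero t => ElimZero (rename r t)
  | Pair t u => Pair (rename r t) (rename r u)
  | ElimWith1 t A u => ElimWith1 (rename r t) A (rename (up_ren r) u)
  | ElimWith2 t B u => ElimWith2 (rename r t) B (rename (up_ren r) u)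
  | Inl t => Inl (rename r t)
  | Inr t => Inr (rename r t)
  | ElimPlus t A u B v =>
      ElimPlus (rename r t) A (rename (up_ren r) u) B (rename (up_ren r) v)
  | Prom t => Prom (rename r t)
  | ElimBang t A u => ElimBang (rename r t) A (rename (up_ren r) u)
  end.

Definition up_subst (S : Type) (s : nat -> term S) (n : nat) : term S :=
  if n is m.+1 then rename succn (s m) else Var 0.

Fixpoint subst (S : Type) (s : nat -> term S) (t : term S) : term S :=
  match t with
  | Var n => s n
  | Sum t u => Sum (subst s t) (subst s u)
  | Scal a t => Scal a (subst s t)
  | Star a => Star a
  | ElimOne t u => ElimOne (subst s t) (subst s u)
  | Lam A t => Lam A (subst (up_subst s) t)
  | App t u => App (subst s t) (subst s u)
  | Tens t u => Tens (subst s t) (subst s u)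
  | ElimTensor t A B u =>
      ElimTensor (subst s t) A B (subst (up_subst (up_subst s)) u)
  | Unit => Unit
  | ElimZero t => ElimZero (subst s t)
  | Pair t u => Pair (subst s t) (subst s u)
  | ElimWith1 t A u => ElimWith1 (subst s t) A (subst (up_subst s) u)
  | ElimWith2 t B u => ElimWith2 (subst s t) B (subst (up_subst s) u)
  | Inl t => Inl (subst s t)
  | Inr t => Inr (subst s t)
  | ElimPlus t A u B v =>
      ElimPlus (subst s t) A (subst (up_subst s) u) B (subst (up_subst s) v)
  | Prom t => Prom (subst s t)
  | ElimBang t A u => ElimBang (subst s t) A (subst (up_subst s) u)
  end.

(* (u/x)t, where x is the variable 0 of t *)
Definition subst1 (S : Type) (u t : term S) : term S :=
  subst (fun n => if n is m.+1 then Var m else u) t.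

(* (u/x, v/y)t, where x and y are the variables 1 and 0 of t *)
Definition subst2 (S : Type) (u v t : term S) : term S :=
  subst (fun n => match n with 0 => v | 1 => u | m.+2 => Var m end) t.

(* A finite set of typed variables: x^A belongs to G iff [lookup G x = Some A]. *)
(* A [None] entry is a variable that is not in the set, so extending a context  *)
(* with [Some A] introduces the innermost bound variable, with type A, and      *)
(* extending it with [None] only shifts its variables.                          *)
Definition context := seq (option proposition).

Definition lookup (G : context) (x : nat) : option proposition := nth None G x.

Definition is_empty (G : context) : Prop := forall x, lookup G x = None.

Definition is_single (G : context) (x : nat) (A : proposition) : Prop :=
  forall y, lookup G y = if y == x then Some A else None.

Definition disjoint_ctx (G D : context) : Prop :=
  forall x, lookup G x = None \/ lookup D x = None.

(* H is the disjoint union of G and D *)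
Definition is_union (H G D : context) : Prop :=
  disjoint_ctx G D /\
  forall x, lookup H x = if lookup G x is Some A then Some A else lookup D x.

(* [typed U G t A] is the judgement U; G |- t : A. A variable is never both     *)
(* intuitionistic and linear: this is enforced where linear variables are       *)
(* introduced (TVarLin, TUnit, TElimZero), hence holds of every derivable       *)
(* judgement.                                                                   *)
Inductive typed (S : Type) :
    context -> context -> term S -> proposition -> Prop :=
| TVarLin U G x A :
    is_single G x A -> lookup U x = None -> typed U G (Var x) A
| TVarInt U G x A :
    is_empty G -> lookup U x = Some A -> typed U G (Var x) A
| TSum U G t u A :
    typed U G t A -> typed U G u A -> typed U G (Sum t u) A
| TScal U G a t A :
    typed U G t A -> typed U G (Scal a t) A
| TStar U G a :
    is_empty G -> typed U G (Star a) One
| TElimOne U H G D t u A :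
    is_union H G D -> typed U G t One -> typed U D u A ->
    typed U H (ElimOne t u) A
| TLam U G t A B :
    typed (None :: U) (Some A :: G) t B -> typed U G (Lam A t) (Lolli A B)
| TApp U H G D t u A B :
    is_union H G D -> typed U G t (Lolli A B) -> typed U D u A ->
    typed U H (App t u) B
| TTens U H G D t u A B :
    is_union H G D -> typed U G t A -> typed U D u B ->
    typed U H (Tens t u) (Tensor A B)
| TElimTensor U H G D t u A B C :
    is_union H G D -> typed U G t (Tensor A B) ->
    typed (None :: None :: U) (Some B :: Some A :: D) u C ->
    typed U H (ElimTensor t A B u) C
| TUnit U G :
    disjoint_ctx U G -> typed U G Unit Top
| TElimZero U H G D t C :
    is_union H G D -> disjoint_ctx U D -> typed U G t Zero ->
    typed U H (ElimZero t) C
| TPair U G t u A B :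
    typed U G t A -> typed U G u B -> typed U G (Pair t u) (With A B)
| TElimWith1 U H G D t u A B C :
    is_union H G D -> typed U G t (With A B) ->
    typed (None :: U) (Some A :: D) u C ->
    typed U H (ElimWith1 t A u) C
| TElimWith2 U H G D t u A B C :
    is_union H G D -> typed U G t (With A B) ->
    typed (None :: U) (Some B :: D) u C ->
    typed U H (ElimWith2 t B u) C
| TInl U G t A B :
    typed U G t A -> typed U G (Inl t) (Plus A B)
| TInr U G t A B :
    typed U G t B -> typed U G (Inr t) (Plus A B)
| TElimPlus U H G D t u v A B C :
    is_union H G D -> typed U G t (Plus A B) ->
    typed (None :: U) (Some A :: D) u C ->
    typed (None :: U) (Some B :: D) v C ->
    typed U H (ElimPlus t A u B v) C
| TProm U G t A :
    is_empty G -> typed U G t A -> typed U G (Prom t) (Bang A)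
| TElimBang U H G D t u A B :
    is_union H G D -> typed U G t (Bang A) ->
    typed (Some A :: U) (None :: D) u B ->
    typed U H (ElimBang t A u) B.

Inductive rule (S : comPzSemiRingType) : term S -> term S -> Prop :=
| RElimOne a t : rule (ElimOne (Star a) t) (Scal a t)
| RBeta A t u : rule (App (Lam A t) u) (subst1 u t)
| RElimTensor A B u v w :
    rule (ElimTensor (Tens u v) A B w) (subst2 u v w)
| RElimWith1 A t1 t2 v : rule (ElimWith1 (Pair t1 t2) A v) (subst1 t1 v)
| RElimWith2 B t1 t2 v : rule (ElimWith2 (Pair t1 t2) B v) (subst1 t2 v)
| RElimPlusInl A B t v w : rule (ElimPlus (Inl t) A v B w) (subst1 t v)
| RElimPlusInr A B u v w : rule (ElimPlus (Inr u) A v B w) (subst1 u w)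
| RElimBang A t u : rule (ElimBang (Prom t) A u) (subst1 t u)
| RSumStar a b : rule (Sum (Star a) (Star b)) (Star (a + b)%R)
| RSumLam A t u : rule (Sum (Lam A t) (Lam A u)) (Lam A (Sum t u))
| RSumElimTensor A B t u v :
    rule (ElimTensor (Sum t u) A B v)
         (Sum (ElimTensor t A B v) (ElimTensor u A B v))
| RSumUnit : rule (Sum Unit Unit) Unit
| RSumPair t u v w :
    rule (Sum (Pair t u) (Pair v w)) (Pair (Sum t v) (Sum u w))
| RSumElimPlus A B t u v w :
    rule (ElimPlus (Sum t u) A v B w)
         (Sum (ElimPlus t A v B w) (ElimPlus u A v B w))
| RSumElimBang A t u v :
    rule (ElimBang (Sum t u) A v) (Sum (ElimBang t A v) (ElimBang u A v))
| RScalStar a b : rule (Scal a (Star b)) (Star (a * b)%R)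
| RScalLam a A t : rule (Scal a (Lam A t)) (Lam A (Scal a t))
| RScalElimTensor a A B t v :
    rule (ElimTensor (Scal a t) A B v) (Scal a (ElimTensor t A B v))
| RScalUnit a : rule (Scal a Unit) Unit
| RScalPair a t u : rule (Scal a (Pair t u)) (Pair (Scal a t) (Scal a u))
| RScalElimPlus a A B t v w :
    rule (ElimPlus (Scal a t) A v B w) (Scal a (ElimPlus t A v B w))
| RScalElimBang a A t v :
    rule (ElimBang (Scal a t) A v) (Scal a (ElimBang t A v)).

Inductive ultra_rule (S : comPzSemiRingType) : term S -> term S -> Prop :=
| URule t u : rule t u -> ultra_rule t u
| USumL t u : ultra_rule (Sum t u) t
| USumR t u : ultra_rule (Sum t u) u
| UScal a t : ultra_rule (Scal a t) t.

Inductive context_closure (S : Type) (R : term S -> term S -> Prop) :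
    term S -> term S -> Prop :=
| CBase t t' : R t t' -> context_closure R t t'
| CSumL t t' u :
    context_closure R t t' -> context_closure R (Sum t u) (Sum t' u)
| CSumR t u u' :
    context_closure R u u' -> context_closure R (Sum t u) (Sum t u')
| CScal a t t' :
    context_closure R t t' -> context_closure R (Scal a t) (Scal a t')
| CElimOneL t t' u :
    context_closure R t t' -> context_closure R (ElimOne t u) (ElimOne t' u)
| CElimOneR t u u' :
    context_closure R u u' -> context_closure R (ElimOne t u) (ElimOne t u')
| CLam A t t' :
    context_closure R t t' -> context_closure R (Lam A t) (Lam A t')
| CAppL t t' u :
    context_closure R t t' -> context_closure R (App t u) (App t' u)
| CAppR t u u' :
    context_closure R u u' -> context_closure R (App t u) (App t u')
| CTensL t t' u :
    context_closure R t t' -> context_closure R (Tens t u) (Tens t' u)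
| CTensR t u u' :
    context_closure R u u' -> context_closure R (Tens t u) (Tens t u')
| CElimTensorL t t' A B u :
    context_closure R t t' ->
    context_closure R (ElimTensor t A B u) (ElimTensor t' A B u)
| CElimTensorR t A B u u' :
    context_closure R u u' ->
    context_closure R (ElimTensor t A B u) (ElimTensor t A B u')
| CElimZero t t' :
    context_closure R t t' -> context_closure R (ElimZero t) (ElimZero t')
| CPairL t t' u :
    context_closure R t t' -> context_closure R (Pair t u) (Pair t' u)
| CPairR t u u' :
    context_closure R u u' -> context_closure R (Pair t u) (Pair t u')
| CElimWith1L t t' A u :
    context_closure R t t' ->
    context_closure R (ElimWith1 t A u) (ElimWith1 t' A u)
| CElimWith1R t A u u' :
    context_closure R u u' ->
    context_closure R (ElimWith1 t A u) (ElimWith1 t A u')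
| CElimWith2L t t' B u :
    context_closure R t t' ->
    context_closure R (ElimWith2 t B u) (ElimWith2 t' B u)
| CElimWith2R t B u u' :
    context_closure R u u' ->
    context_closure R (ElimWith2 t B u) (ElimWith2 t B u')
| CInl t t' :
    context_closure R t t' -> context_closure R (Inl t) (Inl t')
| CInr t t' :
    context_closure R t t' -> context_closure R (Inr t) (Inr t')
| CElimPlusL t t' A u B v :
    context_closure R t t' ->
    context_closure R (ElimPlus t A u B v) (ElimPlus t' A u B v)
| CElimPlusM t A u u' B v :
    context_closure R u u' ->
    context_closure R (ElimPlus t A u B v) (ElimPlus t A u' B v)
| CElimPlusR t A u B v v' :
    context_closure R v v' ->
    context_closure R (ElimPlus t A u B v) (ElimPlus t A u B v')
| CProm t t' :
    context_closure R t t' -> context_closure R (Prom t) (Prom t')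
| CElimBangL t t' A u :
    context_closure R t t' ->
    context_closure R (ElimBang t A u) (ElimBang t' A u)
| CElimBangR t A u u' :
    context_closure R u u' ->
    context_closure R (ElimBang t A u) (ElimBang t A u').

Definition ultra_red (S : comPzSemiRingType) : term S -> term S -> Prop :=
  context_closure (@ultra_rule S).

Definition SN (S : comPzSemiRingType) (t : term S) : Prop :=
  ~ exists s : nat -> term S,
      s 0 = t /\ forall n : nat, ultra_red (s n) (s n.+1).

(* Main.v *)
(** Tait's method, in an untyped setting. A term is reducible of type [A] when
    it has no infinite ultra-reduction and each introduction met along its
    reductions is the introduction of the connective of [A], with reducible
    components. As ultra-reduction contains [t [+] u --> t], [t [+] u --> u] and
    [a . t --> t], the summands of a reducible sum are reducible; this makes the
    commuting reductions, such as
    [delta (t [+] u, v) --> delta (t, v) [+] delta (u, v)], decrease towards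
    terms that the induction hypothesis covers. Linearity plays no role. *)
Require Import Defs.
From mathcomp Require Import all_boot ssralg.

Set Implicit Arguments.
Unset Strict Implicit.
Unset Printing Implicit Defensive.

(** * Substitution *)

Section Substitution.
Variable S : Type.
Implicit Types (r : nat -> nat) (s : nat -> term S) (t u v w : term S).

(* The composition lemmas take the composite as a separate argument, given
   pointwise, so that they also serve as extensionality lemmas. *)
Lemma rename_rename t r1 r2 r3 :
  (forall n, r2 (r1 n) = r3 n) -> rename r2 (rename r1 t) = rename r3 t.
Proof.
have up q1 q2 q3 : (forall n, q2 (q1 n) = q3 n) ->
    forall n, up_ren q2 (up_ren q1 n) = up_ren q3 n.
  by move=> e [|n] //=; rewrite e.
by elim: t r1 r2 r3 => /= *; first [solve [eauto] | f_equal; eauto].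
Qed.

Lemma subst_rename t r s s' :
  (forall n, s (r n) = s' n) -> subst s (rename r t) = subst s' t.
Proof.
have up q z z' : (forall n, z (q n) = z' n) ->
    forall n, up_subst z (up_ren q n) = up_subst (S := S) z' n.
  by move=> e [|n] //=; rewrite e.
by elim: t r s s' => /= *; first [solve [eauto] | f_equal; eauto].
Qed.

Lemma rename_subst t r s s' :
  (forall n, rename r (s n) = s' n) -> rename r (subst s t) = subst s' t.
Proof.
have up q z z' : (forall n, rename q (z n) = z' n) ->
    forall n, rename (up_ren q) (up_subst z n) = up_subst (S := S) z' n.
  move=> e [|n] //=; rewrite -e (@rename_rename _ _ _ (fun m => (q m).+1)) //.
  by rewrite (@rename_rename _ _ _ (fun m => (q m).+1)).
by elim: t r s s' => /= *; first [solve [eauto] | f_equal; eauto 6].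
Qed.

Lemma subst_subst t s1 s2 s3 :
  (forall n, subst s2 (s1 n) = s3 n) -> subst s2 (subst s1 t) = subst s3 t.
Proof.
have up z1 z2 z3 : (forall n, subst z2 (z1 n) = z3 n) ->
    forall n, subst (up_subst z2) (up_subst z1 n) = up_subst (S := S) z3 n.
  move=> e [|n] //=; rewrite -e.
  rewrite (@subst_rename _ _ _ (fun m => rename succn (z2 m))) //.
  by rewrite (@rename_subst _ _ _ (fun m => rename succn (z2 m))).
by elim: t s1 s2 s3 => /= *; first [solve [eauto] | f_equal; eauto 6].
Qed.

Lemma subst_Var t s : (forall n, s n = Var n) -> subst s t = t.
Proof.
have up z : (forall n, z n = Var n) -> forall n, up_subst z n = Var (S := S) n.
  by move=> e [|n] //=; rewrite e.
by elim: t s => /= *; first [solve [eauto] | f_equal; eauto 6].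
Qed.

Definition scons u s (n : nat) : term S := if n is m.+1 then s m else u.

(** Adequacy reaches a body through [up_subst s], and [body] then plugs the bound variable. Fusing
    the two into [scons u s] gives the form to which the induction hypothesis applies. *)
Lemma subst1_up s u t : subst1 u (subst (up_subst s) t) = subst (scons u s) t.
Proof.
apply: subst_subst => -[|n] //=.
by rewrite (@subst_rename _ _ _ Var) // subst_Var.
Qed.

Lemma subst2_up s u v t :
  subst2 u v (subst (up_subst (up_subst s)) t) = subst (scons v (scons u s)) t.
Proof.
apply: subst_subst => -[|[|n]] //=.
(* Beyond the two bound variables, [s n] has been shifted twice; the outer shift cancels [v], the
   inner one cancels [u]. *)
rewrite (@subst_rename _ _ _ (scons u Var)); last by case.
by rewrite (@subst_rename _ _ _ Var) // subst_Var.
Qed.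

Lemma subst_subst1 s u t :
  subst s (subst1 u t) = subst1 (subst s u) (subst (up_subst s) t).
Proof. by rewrite subst1_up; apply: subst_subst => -[|n]. Qed.

Lemma subst_subst2 s u v t :
  subst s (subst2 u v t) =
  subst2 (subst s u) (subst s v) (subst (up_subst (up_subst s)) t).
Proof. by rewrite subst2_up; apply: subst_subst => -[|[|n]]. Qed.

End Substitution.

(** * Ultra-reduction under substitution, and strong normalisation as accessibility *)

Section StrongNormalisation.
Variable S : comPzSemiRingType.
Implicit Types (s : nat -> term S) (t u v w : term S) (A B C : proposition).

Lemma ultra_red_subst s t t' :
  ultra_red t t' -> ultra_red (subst s t) (subst s t').
Proof.
rewrite /ultra_red => h; elim: h s => {t t'};
  try by move=> *; constructor; solve [auto].
move=> t t' h s; constructor; case: h => {t t'} [t t' h|||] /=;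
  try by constructor.
by constructor; case: h => *; rewrite /= ?subst_subst1 ?subst_subst2;
  constructor.
Qed.

Definition sn t := Acc (fun x y => ultra_red y x) t.

Lemma sn_SN t : sn t -> SN t.
Proof.
elim=> {}t _ IH [f [f0 fS]]; apply: (IH (f 1)); first by rewrite -f0.
by exists (fun n => f n.+1); split=> // n; exact: fS.
Qed.

(** Each reduction of [t] is mirrored by one of [subst s t]. This recovers strong normalisation of
    an open body from that of one of its instances. *)
Lemma sn_subst s t : sn (subst s t) -> sn t.
Proof.
move e: (subst s t) => u h; elim: h t e => {}u _ IH t e.
constructor=> t' tt'; apply: IH (erefl (subst s t')).
by rewrite -e; exact: ultra_red_subst.
Qed.

(** * Reducibility *)

(* [done] must not be run on a goal [hereditary P t], nor on a goal [sn t]: both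
   predicates have a single constructor, so it would split the goal forever. *)
Inductive hereditary (P : term S -> Prop) t : Prop :=
  Hereditary of P t & (forall t', ultra_red t t' -> hereditary P t').

Lemma hereditary_now P t : hereditary P t -> P t.
Proof. by case. Qed.

Lemma hereditary_red P t t' : hereditary P t -> ultra_red t t' ->
  hereditary P t'.
Proof. by case=> _; apply. Qed.

Lemma hereditary_sn P t : hereditary P t -> sn t.
Proof. by elim=> {}t _ _ IH; constructor. Qed.

Lemma hereditary_intro P t : sn t ->
  (forall u v, ultra_red u v -> P u -> P v) -> P t -> hereditary P t.
Proof.
move=> snt closed; elim: snt => {}t _ IH pt; split; first exact: pt.
by move=> t' h; apply: IH h (closed _ _ h pt).
Qed.

(** Two nested inductions, the outer one generalised over [u]: after a step of [t], the hypothesis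
    holds for any hereditary second term. *)
Lemma hereditary_ind2 P Q (R : term S -> term S -> Prop) :
  (forall t u, hereditary P t -> hereditary Q u ->
     (forall t', ultra_red t t' -> R t' u) ->
     (forall u', ultra_red u u' -> R t u') -> R t u) ->
  forall t u, hereditary P t -> hereditary Q u -> R t u.
Proof.
move=> step t u ht; elim: ht u => {}t pt rt IHt u hu.
elim: (hu) => {hu} u qu ru IHu; apply: step IHu; try exact: Hereditary.
by move=> t' h; apply: (IHt _ h); exact: Hereditary.
Qed.

(** Sums and scalar multiples count as neutral, although some eliminations commute with them: a
    commuting step only eliminates the summands, which are themselves ultra-reducts. *)
Definition neutral t : bool :=
  match t with
  | Star _ | Lam _ _ | Tens _ _ | Unit | Pair _ _ | Inl _ | Inr _ | Prom _ =>
      false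
  | _ => true
  end.

(** A condition on the head constructor alone; [hereditary] propagates it to all reducts.
    Reducibility occurs negatively in the case [Lolli], hence the recursion on the proposition. *)
Fixpoint value A t : Prop :=
  match A with
  | One => if t is Star _ then true else neutral t
  | Lolli A B =>
      if t is Lam _ u then
        forall v, hereditary (value A) v -> hereditary (value B) (subst1 v u)
      else neutral t
  | Tensor A B =>
      if t is Tens u v then hereditary (value A) u /\ hereditary (value B) v
      else neutral t
  | Top => if t is Unit then true else neutral t
  | Zero => neutral t
  | With A B =>
      if t is Pair u v then hereditary (value A) u /\ hereditary (value B) v
      else neutral t
  | Plus A B =>
      match t with
      | Inl u => hereditary (value A) u
      | Inr v => hereditary (value B) v
      | _ => neutral t
      end
  | Bang A => if t is Prom u then hereditary (value A) u else neutral t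
  end.

Notation reducible A := (hereditary (value A)).

Lemma neutral_value A t : neutral t -> value A t.
Proof. by case: A; case: t. Qed.

(** Girard's third condition on reducibility candidates; the first two are [hereditary_sn] and
    [hereditary_red]. *)
Lemma reducible_neutral A t :
  neutral t -> (forall t', ultra_red t t' -> reducible A t') -> reducible A t.
Proof. by move=> nt; constructor=> //; exact: neutral_value. Qed.

Ltac inv h := inversion h; subst; clear h.

Ltac inv_red h :=
  inv h; try match goal with
  | h' : ultra_rule _ _ |- _ =>
      inv h'; try match goal with h'' : rule _ _ |- _ => inv h'' end
  end.

Lemma reducible_Var A n : reducible A (Var n).
Proof. by apply: reducible_neutral; last (move=> t' h; inv_red h). Qed.

Definition body A B t : Prop :=
  forall v, reducible A v -> reducible B (subst1 v t).

Definition body2 A B C t : Prop :=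
  forall u v, reducible A u -> reducible B v -> reducible C (subst2 u v t).

(** This allows induction on the reductions of a term under a binder. Such a term is strongly
    normalising because its instance at a variable is reducible, and [body] is stable because
    reduction commutes with substitution. *)
Lemma hereditary_body A B t : body A B t -> hereditary (body A B) t.
Proof.
move=> h; apply: (hereditary_intro _ _ h).
  by apply/sn_subst/hereditary_sn/h; exact: (reducible_Var A 0).
move=> u v uv hu w rw; apply: hereditary_red (hu w rw) _.
exact: ultra_red_subst.
Qed.

Lemma hereditary_body2 A B C t : body2 A B C t -> hereditary (body2 A B C) t.
Proof.
move=> h; apply: (hereditary_intro _ _ h).
  apply/sn_subst/hereditary_sn/h; first exact: (reducible_Var A 0).
  exact: (reducible_Var B 0).
move=> u v uv hu w1 w2 r1 r2; apply: hereditary_red (hu w1 w2 r1 r2) _.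
exact: ultra_red_subst.
Qed.

(** * Introductions *)

Lemma reducible_Star a : reducible One (Star a).
Proof. by split; last (move=> t' h; inv_red h). Qed.

Lemma reducible_Unit : reducible Top Unit.
Proof. by split; last (move=> t' h; inv_red h). Qed.

Lemma reducible_Lam A B C t : body A B t -> reducible (Lolli A B) (Lam C t).
Proof.
move/hereditary_body; elim=> {}t vt _ IH; split; first exact: vt.
by move=> t' h; inv_red h; exact: IH.
Qed.

Lemma reducible_Tens A B t u :
  reducible A t -> reducible B u -> reducible (Tensor A B) (Tens t u).
Proof.
move: t u; apply: hereditary_ind2 => t u rt ru IHt IHu; split.
  by split; [exact: rt | exact: ru].
by move=> w h; inv_red h; [exact: IHt | exact: IHu].
Qed.

Lemma reducible_Pair A B t u :
  reducible A t -> reducible B u -> reducible (With A B) (Pair t u).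
Proof.
move: t u; apply: hereditary_ind2 => t u rt ru IHt IHu; split.
  by split; [exact: rt | exact: ru].
by move=> w h; inv_red h; [exact: IHt | exact: IHu].
Qed.

Lemma reducible_Inl A B t : reducible A t -> reducible (Plus A B) (Inl t).
Proof.
elim=> {}t vt ht IH; split; first exact: Hereditary.
by move=> t' h; inv_red h; exact: IH.
Qed.

Lemma reducible_Inr A B t : reducible B t -> reducible (Plus A B) (Inr t).
Proof.
elim=> {}t vt ht IH; split; first exact: Hereditary.
by move=> t' h; inv_red h; exact: IH.
Qed.

Lemma reducible_Prom A t : reducible A t -> reducible (Bang A) (Prom t).
Proof.
elim=> {}t vt ht IH; split; first exact: Hereditary.
by move=> t' h; inv_red h; exact: IH.
Qed.

(** * Sums and scalar multiples *)

Lemma reducible_Sum A t u :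
  reducible A t -> reducible A u -> reducible A (Sum t u).
Proof.
(* Only abstractions and pairs merge into sums of their components, so only [Lolli] (for its
   codomain) and [With] call on smaller propositions. *)
elim: A t u => [|A _ B IHB|A _ B _|||A IHA B IHB|A _ B _|A _];
  apply: hereditary_ind2 => t u rt ru IHt IHu;
  have [vt vu] := (hereditary_now rt, hereditary_now ru);
  apply: reducible_neutral; try exact: isT; move=> w h; inv_red h;
  (* The contraction of [Sum Unit Unit] is closed here too, its result being equal to a summand. *)
  try exact: rt; try exact: ru; try exact: IHt; try exact: IHu;
  (* a summand is an introduction of another connective *)
  try (exfalso; done).
- exact: reducible_Star.
- apply: reducible_Lam => v rv; rewrite /subst1 /=.
  by apply: IHB; [exact: vt | exact: vu].
- by case: vt vu => ? ? [? ?]; apply: reducible_Pair; [exact: IHA | exact: IHB].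
Qed.

Lemma reducible_Scal A a t : reducible A t -> reducible A (Scal a t).
Proof.
elim: A t => [|A _ B IHB|A _ B _|||A IHA B IHB|A _ B _|A _] t;
  move=> rt; elim: (rt) => {rt} t vt ht IHt; have rt := Hereditary vt ht;
  apply: reducible_neutral; try exact: isT; move=> w h; inv_red h;
  try exact: rt; try exact: IHt; try (exfalso; done).
- exact: reducible_Star.
- by apply: reducible_Lam => v rv; rewrite /subst1 /=; apply: IHB; exact: vt.
- by case: vt => ? ?; apply: reducible_Pair; [exact: IHA | exact: IHB].
Qed.

Lemma ultra_red_SumL t u : ultra_red (Sum t u) t.
Proof. by do 2 constructor. Qed.

Lemma ultra_red_SumR t u : ultra_red (Sum t u) u.
Proof. by constructor; exact: USumR. Qed.

Lemma ultra_red_Scal a t : ultra_red (Scal a t) t.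
Proof. by do 2 constructor. Qed.

(** * Eliminations *)

Lemma reducible_ElimOne A t u :
  reducible One t -> reducible A u -> reducible A (ElimOne t u).
Proof.
move: t u; apply: hereditary_ind2 => t u rt ru IHt IHu.
apply: reducible_neutral; first exact: isT.
move=> w h; inv_red h; [|exact: IHt|exact: IHu].
exact: reducible_Scal.
Qed.

Lemma reducible_App A B t u :
  reducible (Lolli A B) t -> reducible A u -> reducible B (App t u).
Proof.
move: t u; apply: hereditary_ind2 => t u rt ru IHt IHu.
apply: reducible_neutral; first exact: isT.
move=> w h; inv_red h; [|exact: IHt|exact: IHu].
exact: (hereditary_now rt).
Qed.

Lemma reducible_ElimZero A t : reducible Zero t -> reducible A (ElimZero t).
Proof.
elim=> {}t vt ht IHt; apply: reducible_neutral; first exact: isT.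
by move=> w h; inv_red h; exact: IHt.
Qed.

Lemma reducible_ElimTensor A B C A' B' t u :
  reducible (Tensor A B) t -> body2 A B C u ->
  reducible C (ElimTensor t A' B' u).
Proof.
move=> rt /hereditary_body2; move: t u rt.
apply: hereditary_ind2 => t u rt ru IHt IHu.
apply: reducible_neutral; first exact: isT.
move=> w h; inv_red h; [| | |exact: IHt|exact: IHu].
- by case: (hereditary_now rt) => ? ?; exact: (hereditary_now ru).
- apply: reducible_Sum; apply: IHt;
  [exact: ultra_red_SumL|exact: ultra_red_SumR].
- by apply: reducible_Scal; apply: IHt; exact: ultra_red_Scal.
Qed.

Lemma reducible_ElimWith1 A B C A' t u :
  reducible (With A B) t -> body A C u -> reducible C (ElimWith1 t A' u).
Proof.
move=> rt /hereditary_body; move: t u rt.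
apply: hereditary_ind2 => t u rt ru IHt IHu.
apply: reducible_neutral; first exact: isT.
move=> w h; inv_red h; [|exact: IHt|exact: IHu].
by case: (hereditary_now rt) => ? _; exact: (hereditary_now ru).
Qed.

Lemma reducible_ElimWith2 A B C B' t u :
  reducible (With A B) t -> body B C u -> reducible C (ElimWith2 t B' u).
Proof.
move=> rt /hereditary_body; move: t u rt.
apply: hereditary_ind2 => t u rt ru IHt IHu.
apply: reducible_neutral; first exact: isT.
move=> w h; inv_red h; [|exact: IHt|exact: IHu].
by case: (hereditary_now rt) => _ ?; exact: (hereditary_now ru).
Qed.

Lemma reducible_ElimPlus A B C A' B' t u v :
  reducible (Plus A B) t -> body A C u -> body B C v ->
  reducible C (ElimPlus t A' u B' v).
Proof.
(* [v] stays generalised, so that a third induction, on its reductions, can be nested inside the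
   joint one on [t] and [u]. *)
move=> rt /hereditary_body ru /hereditary_body; move: t u rt ru v.
apply: hereditary_ind2 => t u rt ru IHt IHu v rv.
elim: (rv) => {rv} v vv hv IHv; have rv := Hereditary vv hv.
apply: reducible_neutral; first exact: isT.
move=> w h; inv_red h; [| | | |exact: IHt|exact: IHu|exact: IHv].
- by apply: (hereditary_now ru); exact: (hereditary_now rt).
- by apply: vv; exact: (hereditary_now rt).
- apply: reducible_Sum; apply: IHt; try exact: rv.
    exact: ultra_red_SumL.
  exact: ultra_red_SumR.
- by apply: reducible_Scal; apply: IHt; [exact: ultra_red_Scal|exact: rv].
Qed.

Lemma reducible_ElimBang A C A' t u :
  reducible (Bang A) t -> body A C u -> reducible C (ElimBang t A' u).
Proof.
move=> rt /hereditary_body; move: t u rt.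
apply: hereditary_ind2 => t u rt ru IHt IHu.
apply: reducible_neutral; first exact: isT.
move=> w h; inv_red h; [| | |exact: IHt|exact: IHu].
- by apply: (hereditary_now ru); exact: (hereditary_now rt).
- apply: reducible_Sum; apply: IHt;
  [exact: ultra_red_SumL|exact: ultra_red_SumR].
- by apply: reducible_Scal; apply: IHt; exact: ultra_red_Scal.
Qed.

(** * Adequacy *)

Definition adequate (G : context) s :=
  forall x A, lookup G x = Some A -> reducible A (s x).

Lemma adequate_union H G D s : is_union H G D ->
  adequate H s -> adequate G s /\ adequate D s.
Proof.
move=> [dGD eH] rH; split=> x A e; apply: rH; rewrite eH ?e //.
(* [lookup H] consults [G] first; disjointness makes it fall through to [D] on the variables of
   [D]. *)
by case: (dGD x) => [->|]; rewrite ?e.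
Qed.

Lemma adequate_Some G s A v : adequate G s -> reducible A v ->
  adequate (Some A :: G) (scons v s).
Proof. by move=> rG rv [|x] B /= => [[<-]|/rG]. Qed.

(** A [None] entry declares no variable and so constrains no term. Hence one [scons v s] serves both
    contexts when a binder extends only one of them. *)
Lemma adequate_None G s v :
  adequate G s -> adequate (None :: G) (scons v s).
Proof. by move=> rG [|x] B; [discriminate | exact: rG]. Qed.

(** By induction on the derivation, for all [s], since each binder extends [s] with an arbitrary
    reducible term. Both contexts share [s] because variables form a single class. *)
Lemma typed_reducible U G t A s : typed U G t A ->
  adequate U s -> adequate G s -> reducible A (subst s t).
Proof.
move=> h; elim: h s => {U G t A} /=.
- by move=> U G x A eG _ s _; apply; rewrite eG eqxx.
- by move=> U G x A _ e s rU _; exact: rU.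
- by move=> U G t u A _ IHt _ IHu s rU rG; apply: reducible_Sum;
    [exact: IHt | exact: IHu].
- by move=> U G a t A _ IHt s rU rG; apply: reducible_Scal; exact: IHt.
- by move=> *; exact: reducible_Star.
- move=> U H G D t u A e _ IHt _ IHu s rU /(adequate_union e)[rG rD].
  by apply: reducible_ElimOne; [exact: IHt | exact: IHu].
- move=> U G t A B _ IHt s rU rG; apply: reducible_Lam => v rv.
  by rewrite subst1_up; apply: IHt;
    [exact: adequate_None | exact: adequate_Some].
- move=> U H G D t u A B e _ IHt _ IHu s rU /(adequate_union e)[rG rD].
  by apply: reducible_App; [exact: IHt | exact: IHu].
- move=> U H G D t u A B e _ IHt _ IHu s rU /(adequate_union e)[rG rD].
  by apply: reducible_Tens; [exact: IHt | exact: IHu].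
- move=> U H G D t u A B C e _ IHt _ IHu s rU /(adequate_union e)[rG rD].
  apply: reducible_ElimTensor; first exact: IHt.
  move=> v w rv rw; rewrite subst2_up; apply: IHu;
    first by do 2 apply: adequate_None.
  by apply: adequate_Some rw; exact: adequate_Some.
- by move=> *; exact: reducible_Unit.
- move=> U H G D t C e _ _ IHt s rU /(adequate_union e)[rG _].
  by apply: reducible_ElimZero; exact: IHt.
- move=> U G t u A B _ IHt _ IHu s rU rG.
  by apply: reducible_Pair; [exact: IHt | exact: IHu].
- move=> U H G D t u A B C e _ IHt _ IHu s rU /(adequate_union e)[rG rD].
  apply: reducible_ElimWith1; [exact: IHt | move=> v rv].
  by rewrite subst1_up; apply: IHu;
    [exact: adequate_None | exact: adequate_Some].
- move=> U H G D t u A B C e _ IHt _ IHu s rU /(adequate_union e)[rG rD].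
  apply: reducible_ElimWith2; [exact: IHt | move=> v rv].
  by rewrite subst1_up; apply: IHu;
    [exact: adequate_None | exact: adequate_Some].
- by move=> U G t A B _ IHt s rU rG; apply: reducible_Inl; exact: IHt.
- by move=> U G t A B _ IHt s rU rG; apply: reducible_Inr; exact: IHt.
- move=> U H G D t u v A B C e _ IHt _ IHu _ IHv s rU.
  case/(adequate_union e) => rG rD.
  apply: reducible_ElimPlus; [exact: IHt | move=> w rw | move=> w rw].
    by rewrite subst1_up; apply: IHu;
      [exact: adequate_None | exact: adequate_Some].
  by rewrite subst1_up; apply: IHv;
    [exact: adequate_None | exact: adequate_Some].
- by move=> U G t A _ _ IHt s rU rG; apply: reducible_Prom; exact: IHt.
- move=> U H G D t u A B e _ IHt _ IHu s rU /(adequate_union e)[rG rD].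
  apply: reducible_ElimBang; [exact: IHt | move=> v rv].
  by rewrite subst1_up; apply: IHu;
    [exact: adequate_Some | exact: adequate_None].
Qed.

End StrongNormalisation.

Theorem theorem2p12 (S : comPzSemiRingType) (U G : context) (t : term S)
    (A : proposition) (Ht : typed U G t A) : SN t.
Proof.
(* The identity substitution is adequate for every context, variables being reducible at every
   proposition. *)
have <- : subst Var t = t by exact: subst_Var.
apply/sn_SN/hereditary_sn; apply: typed_reducible Ht _ _ => x B _;
  exact: reducible_Var.
Qed.
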